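(* Let $F:\mathbb{R}^d\to\mathbb{R}^d$ be monotone and differentiable with $\|DF(z)-DF(z')\|_{\mathrm{op}}\le L_2\|z-z'\|$ for all $z,z'\in\mathbb{R}^d$, where $L_2>0$; let $H:\mathbb{R}^d\rightrightarrows\mathbb{R}^d$ be maximally monotone, and let $z^*$ satisfy $0\in F(z^* )+H(z^* )$. Let $z_0\in\operatorname{dom}(H)$ and $\varepsilon>0$. Consider the AEP Newton method (defined in the context). At every outer iteration $k$ before termination, the line search returns after $$\mathcal{O}\left(1+\log\left(1+\frac{L_2\|z_0-z^*\|^2}{\varepsilon}\right)\right)$$ trial evaluations, including the initial trial at $a=\bar a_k$ (the hidden constant being universal).
   Context: Norms are Euclidean; $\operatorname{dom}(H)=\{z:H(z)\neq\emptyset\}$. AEP Newton method. Input: $z_0\in\operatorname{dom}(H)$, $\varepsilon>0$, $L_2>0$. Choose $v_0\in H(z_0)$ and set $A_0=0$. For $k=0,1,2,\dots$: (1) If $\|F(z_k)+v_k\|\le\varepsilon$, stop and return $z_k$. (2) Otherwise run the line search. For a trial step size $a>0$, a trial evaluation consists of computing $$z_{k+1/2}(a)=\frac{a}{A_k+a}z_0+\frac{A_k}{A_k+a}\bigl(z_k-a(F(z_k)+v_k)\bigr),$$ the affine model $P_{k,a}(z)=F(z_{k+1/2}(a))+DF(z_{k+1/2}(a))(z-z_{k+1/2}(a))$, the unique solution $z_{k+1}(a)$ of $$0\in aP_{k,a}(z_{k+1}(a))+aH(z_{k+1}(a))+z_{k+1}(a)-\Bigl(\frac{a}{A_k+a}z_0+\frac{A_k}{A_k+a}z_k\Bigr),$$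 and $$v_{k+1}(a)=\frac1a\Bigl(\frac{a}{A_k+a}z_0+\frac{A_k}{A_k+a}z_k-z_{k+1}(a)\Bigr)-P_{k,a}(z_{k+1}(a))\in H(z_{k+1}(a)).$$ The merit function is $\phi_k(a)=L_2\,a\,\|z_{k+1}(a)-z_{k+1/2}(a)\|$ for $a>0$, $\phi_k(0)=0$. The upper trial value is $$\bar a_k=\max\left\{\frac{2A_k\|F(z_k)+v_k\|}{\varepsilon},\ \sqrt{\frac{2(1+\sqrt2)}{L_2\varepsilon}}\right\}.$$ First evaluate the trial $a=\bar a_k$. If $\phi_k(\bar a_k)\le\sqrt2$, the whole method terminates and returns $z_{k+1}(\bar a_k)$ (this counts as the line search returning). Otherwise set $a^-=0$, $a^+=\bar a_k$ and repeat (bisection phase): evaluate the trial $a=(a^-+a^+)/2$; if $\phi_k(a)<1$ set $a^-\leftarrow a$; if $\phi_k(a)>\sqrt2$ set $a^+\leftarrow a$; otherwise accept $a_k=a$, and the line search returns. (3) After acceptance set $z_{k+1/2}=z_{k+1/2}(a_k)$, $z_{k+1}=z_{k+1}(a_k)$, $v_{k+1}=v_{k+1}(a_k)$, $A_{k+1}=A_k+a_k$. ''Outer iteration $k$ before termination'' means that iteration $k$ is reached and the line search in step (2) is invoked there. *)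

(* Defs.v *)
From HB Require Import structures.
From mathcomp Require Import all_boot all_order all_algebra.
From mathcomp Require Import all_classical all_reals all_analysis.
Set Implicit Arguments.
Unset Strict Implicit.
Unset Printing Implicit Defensive.
Import Order.TTheory GRing.Theory Num.Theory.
Import numFieldNormedType.Exports.
Local Open Scope classical_set_scope.
Local Open Scope ring_scope.

Section Euclidean.
Context {R : realType} {d : nat}.
Implicit Types u v z w : 'rV[R]_d.

Definition dot u v : R := \sum_(i < d) u ord0 i * v ord0 i.

(* The library norm `|u| on 'rV[R]_d is the sup norm, so the Euclidean norm is
   defined here.  Both norms induce the same topology, hence the library
   differential 'd F z is the usual Frechet derivative. *)
Definition enorm u : R := Num.sqrt (dot u u).

Definition opnorm (T : 'rV[R]_d -> 'rV[R]_d) : R :=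
  sup [set enorm (T u) | u in [set u | enorm u <= 1]].

Definition monotone_map (F : 'rV[R]_d -> 'rV[R]_d) : Prop :=
  forall z w, 0 <= dot (F z - F w) (z - w).

Definition monotone_op (H : 'rV[R]_d -> set 'rV[R]_d) : Prop :=
  forall z w u v, H z u -> H w v -> 0 <= dot (u - v) (z - w).

Definition maximally_monotone (H : 'rV[R]_d -> set 'rV[R]_d) : Prop :=
  monotone_op H /\
  forall G : 'rV[R]_d -> set 'rV[R]_d, monotone_op G ->
    (forall z, H z `<=` G z) -> forall z, G z `<=` H z.

Definition domain (H : 'rV[R]_d -> set 'rV[R]_d) : set 'rV[R]_d :=
  [set z | H z !=set0].

End Euclidean.

Record state (R : realType) (d : nat) := State {
  st_z : 'rV[R]_d;
  st_v : 'rV[R]_d;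
  st_A : R
}.

(* [Finish z]: the whole method terminates and returns z;
   [Accept s]: a step size is accepted and s is the next iterate. *)
Inductive outcome (R : realType) (d : nat) :=
| Finish of 'rV[R]_d
| Accept of state R d.

Section AEP.
Context {R : realType} {d : nat}.
Variables (F : 'rV[R]_d -> 'rV[R]_d) (H : 'rV[R]_d -> set 'rV[R]_d).
Variables (z0 : 'rV[R]_d) (L2 eps : R).
Implicit Types (s : state R d) (a l u : R) (z : 'rV[R]_d).

Definition residual s : R := enorm (F (st_z s) + st_v s).

Definition zhalf s a : 'rV[R]_d :=
  (a / (st_A s + a)) *: z0
  + (st_A s / (st_A s + a)) *: (st_z s - a *: (F (st_z s) + st_v s)).

Definition anchor s a : 'rV[R]_d :=
  (a / (st_A s + a)) *: z0 + (st_A s / (st_A s + a)) *: st_z s.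

Definition model s a z : 'rV[R]_d :=
  F (zhalf s a) + 'd F (zhalf s a) (z - zhalf s a).

Definition solves_inclusion s a z : Prop :=
  exists2 w, H z w & 0 = a *: model s a z + a *: w + z - anchor s a.

(* [trial s a z]: the trial evaluation at a is well defined and its
   solution z_{k+1}(a) is z. *)
Definition trial s a z : Prop := unique (solves_inclusion s a) z.

(* The state z_{k+1}(a), v_{k+1}(a), A_k + a, where z = z_{k+1}(a). *)
Definition next s a z : state R d :=
  State z (a^-1 *: (anchor s a - z) - model s a z) (st_A s + a).

Definition merit s a z : R := L2 * a * enorm (z - zhalf s a).

Definition abar s : R :=
  Num.max (2 * st_A s * residual s / eps)
          (Num.sqrt (2 * (1 + Num.sqrt 2) / (L2 * eps))).

(* [bisection s l u n s']: the bisection phase, started from a^- = l and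
   a^+ = u, accepts after exactly n trial evaluations, producing s'. *)
Inductive bisection s : R -> R -> nat -> state R d -> Prop :=
| bisection_accept l u z :
    trial s ((l + u) / 2) z ->
    1 <= merit s ((l + u) / 2) z <= Num.sqrt 2 ->
    bisection s l u 1%N (next s ((l + u) / 2) z)
| bisection_small l u z n s' :
    trial s ((l + u) / 2) z ->
    merit s ((l + u) / 2) z < 1 ->
    bisection s ((l + u) / 2) u n s' ->
    bisection s l u n.+1 s'
| bisection_large l u z n s' :
    trial s ((l + u) / 2) z ->
    Num.sqrt 2 < merit s ((l + u) / 2) z ->
    bisection s l ((l + u) / 2) n s' ->
    bisection s l u n.+1 s'.

(* [line_search s n o]: the line search invoked at s returns with outcome o
   after exactly n trial evaluations, the one at [abar s] included. *)
Inductive line_search s : nat -> outcome R d -> Prop :=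
| line_search_finish z :
    trial s (abar s) z ->
    merit s (abar s) z <= Num.sqrt 2 ->
    line_search s 1%N (Finish z)
| line_search_bisect z n s' :
    trial s (abar s) z ->
    Num.sqrt 2 < merit s (abar s) z ->
    bisection s 0 (abar s) n s' ->
    line_search s n.+1 (Accept s').

(* [reached k s]: for some choice of v_0, outer iteration k is reached, with
   s = (z_k, v_k, A_k). *)
Inductive reached : nat -> state R d -> Prop :=
| reached_0 v0 : H z0 v0 -> reached 0 (State z0 v0 0)
| reached_S k s n s' :
    reached k s -> eps < residual s -> line_search s n (Accept s') ->
    reached k.+1 s'.

End AEP.

(* Main.v *)
(* Each trial is well defined because the linearized inclusion is the resolvent
   equation of a maximally monotone operator plus a positive definite linear
   map, which is solvable by Minty's theorem.  Accepted steps have merit at most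
   sqrt 2, which makes the potential A^2 |G|^2 / 2 + A <G, z - z0>, with
   G = F z + v, nonincreasing; hence A |G| <= 2 D and |z - zs| <= 11 D along the
   iterates, where D = |z0 - zs|.  With these bounds the merit at step a is at
   most t (24 + 85 t) for t = L2 a D, and its relative modulus of continuity is
   polynomial in t.  So a bracket with merit below 1 on the left and above
   sqrt 2 on the right has a width of at least abar over a polynomial in
   T = L2 abar D, and T is at most linear in L2 D^2 / eps: bisection stops after
   logarithmically many halvings. *)
From HB Require Import structures.
Require Import Defs.
From mathcomp Require Import all_boot all_order all_algebra.
From mathcomp Require Import all_classical all_reals all_analysis.
From mathcomp Require Import finmap ring lra.
Import Order.TTheory GRing.Theory Num.Theory.
Import numFieldNormedType.Exports.
Local Open Scope classical_set_scope.
Local Open Scope ring_scope.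

(** * Euclidean calculus *)

Section EuclideanTheory.
Context {R : realType} {d : nat}.
Implicit Types (u v w x : 'rV[R]_d) (M : 'M[R]_d).

Lemma dotE u v : dot u v = (u *m v^T) 0 0.
Proof. by rewrite mxE /dot; apply: eq_bigr => i _; rewrite !mxE. Qed.

Lemma dotC u v : dot u v = dot v u.
Proof. by apply: eq_bigr => i _; rewrite mulrC. Qed.

Lemma dotDl u v w : dot (u + v) w = dot u w + dot v w.
Proof. by rewrite !dotE mulmxDl mxE. Qed.

Lemma dotZl a u v : dot (a *: u) v = a * dot u v.
Proof. by rewrite !dotE -scalemxAl mxE. Qed.

Lemma dotNl u v : dot (- u) v = - dot u v.
Proof. by rewrite -scaleN1r dotZl mulN1r. Qed.

Lemma dotDr u v w : dot w (u + v) = dot w u + dot w v.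
Proof. by rewrite dotC dotDl !(dotC _ w). Qed.

Lemma dotZr a u v : dot u (a *: v) = a * dot u v.
Proof. by rewrite dotC dotZl dotC. Qed.

Lemma dotNr u v : dot u (- v) = - dot u v.
Proof. by rewrite dotC dotNl dotC. Qed.

Definition dot_lin := (dotDl, dotDr, dotNl, dotNr, dotZl, dotZr).

Lemma dot0l u : dot 0 u = 0.
Proof. by rewrite dotE mul0mx mxE. Qed.

Lemma dot0r u : dot u 0 = 0.
Proof. by rewrite dotC dot0l. Qed.

Lemma dot_suml (I : Type) (r : seq I) (P : pred I) (f : I -> 'rV[R]_d) v :
  dot (\sum_(i <- r | P i) f i) v = \sum_(i <- r | P i) dot (f i) v.
Proof.
by apply: (big_morph (dot ^~ v)) => [x y|]; rewrite ?dotDl ?dot0l.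
Qed.

Lemma dot_sumr (I : Type) (r : seq I) (P : pred I) (f : I -> 'rV[R]_d) v :
  dot v (\sum_(i <- r | P i) f i) = \sum_(i <- r | P i) dot v (f i).
Proof. by rewrite dotC dot_suml; apply: eq_bigr => i _; rewrite dotC. Qed.

Lemma dotMl M u v : dot (u *m M) v = dot u (v *m M^T).
Proof. by rewrite !dotE trmx_mul trmxK mulmxA. Qed.

Lemma dot_ge0 u : 0 <= dot u u.
Proof. by apply: sumr_ge0 => i _; rewrite -expr2 sqr_ge0. Qed.

Lemma dot_eq0 u : dot u u = 0 -> u = 0.
Proof.
move=> /eqP; rewrite psumr_eq0 => [/allP h|i _]; last by rewrite -expr2 sqr_ge0.
apply/rowP => i; rewrite mxE; have := h i (mem_index_enum i).
by rewrite /= mulf_eq0 orbb => /eqP.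
Qed.

Lemma enorm_ge0 u : 0 <= enorm u.
Proof. exact: sqrtr_ge0. Qed.

Lemma enorm_sqr u : enorm u ^+ 2 = dot u u.
Proof. by rewrite sqr_sqrtr ?dot_ge0. Qed.

Lemma enorm0 : enorm (0 : 'rV[R]_d) = 0.
Proof. by rewrite /enorm dot0l sqrtr0. Qed.

Lemma enorm_eq0 u : enorm u = 0 -> u = 0.
Proof. by move=> h; apply: dot_eq0; rewrite -enorm_sqr h expr0n. Qed.

Lemma enormZ a u : enorm (a *: u) = `|a| * enorm u.
Proof. by rewrite /enorm dotZl dotZr mulrA -expr2 sqrtrM ?sqr_ge0 ?sqrtr_sqr. Qed.

Lemma enormN u : enorm (- u) = enorm u.
Proof. by rewrite -scaleN1r enormZ normrN1 mul1r. Qed.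

Lemma enormBC u v : enorm (u - v) = enorm (v - u).
Proof. by rewrite -enormN opprB. Qed.

Lemma dot_le u v : dot u v <= enorm u * enorm v.
Proof.
have [->|/eqP u0] := eqVneq u 0; first by rewrite dot0l mulr_ge0 ?enorm_ge0.
have [->|/eqP v0] := eqVneq v 0; first by rewrite dot0r mulr_ge0 ?enorm_ge0.
have pu : 0 < enorm u.
  by rewrite lt_neqAle enorm_ge0 andbT eq_sym; apply/eqP => /enorm_eq0.
have pv : 0 < enorm v.
  by rewrite lt_neqAle enorm_ge0 andbT eq_sym; apply/eqP => /enorm_eq0.
have := dot_ge0 (enorm v *: u - enorm u *: v).
rewrite !dot_lin -!enorm_sqr (dotC v u) => h.
by rewrite -(ler_pM2l (mulr_gt0 pu pv)); lra.
Qed.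

Lemma ler_enormD u v : enorm (u + v) <= enorm u + enorm v.
Proof.
rewrite -(@ler_pXn2r _ 2) ?nnegrE ?addr_ge0 ?enorm_ge0 //.
rewrite sqrrD !enorm_sqr !dot_lin (dotC v u).
by have := dot_le u v; lra.
Qed.

Lemma ler_enormB u v : enorm (u - v) <= enorm u + enorm v.
Proof. by rewrite -(enormN v) ler_enormD. Qed.

Lemma ler_enormD_via w u v : enorm (u - v) <= enorm (u - w) + enorm (w - v).
Proof. by apply: le_trans (ler_enormD _ _); rewrite addrA subrK. Qed.

Lemma enorm_le_of_dot u (c : R) :
  0 <= c -> dot u u <= c * enorm u -> enorm u <= c.
Proof.
move=> c0; rewrite -enorm_sqr expr2.
have [->|/eqP u0] := eqVneq (enorm u) 0 => //.
by rewrite ler_pM2r // lt_neqAle enorm_ge0 andbT eq_sym; apply/eqP.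
Qed.

Lemma coord_le_enorm u i : `|u 0 i| <= enorm u.
Proof.
rewrite -sqrtr_sqr ler_sqrt ?dot_ge0 // /dot (bigD1 i) //= -expr2 lerDl.
by apply: sumr_ge0 => j _; rewrite -expr2 sqr_ge0.
Qed.

Lemma ler_enorm_sum (I : Type) (r : seq I) (P : pred I) (f : I -> 'rV[R]_d) :
  enorm (\sum_(i <- r | P i) f i) <= \sum_(i <- r | P i) enorm (f i).
Proof.
elim/big_rec2: _ => [|i y x _ h]; first by rewrite enorm0.
by apply: le_trans (ler_enormD _ _) _; rewrite lerD2l.
Qed.

(** [opnorm] is a [sup], which carries information only for a set that is bounded above. Linearity
    supplies the bound: the images of the basis vectors have finitely many norms, and the
    coordinates of a unit vector are at most 1. *)
Lemma enorm_le_opnorm (T : 'rV[R]_d -> 'rV[R]_d) u :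
  linear T -> enorm (T u) <= opnorm T * enorm u.
Proof.
move=> linT.
pose TL := GRing.isLinear.Build R 'rV[R]_d 'rV[R]_d _ T linT.
pose T' : {linear 'rV[R]_d -> 'rV[R]_d} := HB.pack T TL.
have TZ a x : T (a *: x) = a *: T x by rewrite -[T]/(T' : _ -> _) linearZ.
have bd : has_ubound [set enorm (T x) | x in [set x | enorm x <= 1]].
  exists (\sum_(i < d) enorm (T (delta_mx 0 i))) => _ [x /= x1 <-].
  rewrite (row_sum_delta x) -[T]/(T' : _ -> _) linear_sum /=.
  apply: le_trans (ler_enorm_sum _ _ _ _) _; apply: ler_sum => i _.
  rewrite TZ enormZ ler_piMl ?enorm_ge0 //.
  exact: le_trans (coord_le_enorm _ _) x1.
have [->|/eqP u0] := eqVneq u 0.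
  by rewrite -[T]/(T' : _ -> _) linear0 enorm0 mulr0.
have pu : 0 < enorm u.
  by rewrite lt_neqAle enorm_ge0 andbT eq_sym; apply/eqP => /enorm_eq0.
rewrite -ler_pdivrMr // mulrC; apply: ub_le_sup => //.
exists ((enorm u)^-1 *: u) => /=.
  by rewrite enormZ ger0_norm ?invr_ge0 ?enorm_ge0 // mulVf ?gt_eqF.
by rewrite TZ enormZ ger0_norm ?invr_ge0 ?enorm_ge0.
Qed.

End EuclideanTheory.

(** * Differential calculus along lines: monotonicity and Taylor's bound *)

Lemma mvt_quadratic {R : realType} (g g' : R -> R) (b k : R) :
  (forall t : R, is_derive t 1 g (g' t)) ->
  exists2 c : R, c \in `]0, 1[ & g 1 - g 0 - b - k = g' c - b - k * (2 * c).
Proof.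
(* Subtracting the quadratic before applying the mean value theorem yields the factor 1/2 of the
   Taylor remainder without an integral. *)
move=> dg; pose psi (t : R) := g t - b * t - k * t ^+ 2.
have dpsi (t : R) : is_derive t 1 psi (g' t - b - k * (2 * t)).
  rewrite /psi; apply: is_derive_eq.
  by rewrite -![_ *: _]/(_ * _) !mulr1; ring.
have [|c c01] := @MVT _ psi _ 0 1 ltr01 (fun t _ => dpsi t).
  by apply: derivable_within_continuous => t _; case: (dpsi t).
by rewrite /psi => e; exists c => //; lra.
Qed.

Lemma linear_sub_fun {R : realType} {U V : lmodType R} (f g : {linear U -> V}) :
  linear (fun u => f u - g u).
Proof.
by move=> b u v; rewrite (linearP f) (linearP g) opprD addrACA scalerBr.
Qed.

Section Calculus.
Context {R : realType} {d : nat}.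
Variable F : 'rV[R]_d -> 'rV[R]_d.
Hypothesis dF : forall z, differentiable F z.
Implicit Types p s w x y : 'rV[R]_d.

Lemma is_derive_dot_line p w s (t : R) :
  is_derive t 1 (fun t => dot p (F (w + t *: s))) (dot p ('d F (w + t *: s) s)).
Proof.
have eqf :
  (fun h : R => h^-1 *: ((F \o shift (w + t *: s)) (h *: s) - F (w + t *: s)))
  = (fun h : R => h^-1 *: (((fun t => F (w + t *: s)) \o shift t) (h *: 1)
       - F (w + t *: s))).
  apply/funext => h /=; congr (_ *: (F _ - _)).
  by rewrite /shift /= [h%:A]mulr1 scalerDl addrCA addrA.
have der : derivable (fun t : R => F (w + t *: s)) t 1.
  by have := @diff_derivable _ _ _ F (w + t *: s) s (dF _); rewrite /derivable eqf.
have val : 'D_1 (fun t : R => F (w + t *: s)) t = 'd F (w + t *: s) s.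
  by rewrite -(deriveE s (dF _)) /derive eqf.
have -> : (fun t : R => dot p (F (w + t *: s)))
    = \sum_(i < d) (p 0 i *: (fun t : R => F (w + t *: s) 0 i)).
  by apply/funext => t'; rewrite fct_sumE.
have deri i : is_derive t 1 (fun t : R => F (w + t *: s) 0 i)
    (('d F (w + t *: s) s) 0 i).
  apply: DeriveDef; first by move/derivable_mxP: der; exact.
  by rewrite -val derive_mx // mxE.
by apply: is_derive_sum => i; apply: is_deriveZ.
Qed.

Lemma monotone_diff_ge0 w s : monotone_map F -> 0 <= dot ('d F w s) s.
Proof.
move=> mF; rewrite dotC.
have := is_derive_dot_line s w s 0; rewrite scale0r addr0 => -[der <-].
apply: limr_ge; first exact: der.
near=> h; rewrite /= [h%:A]mulr1 addr0 scale0r addr0 -[_ *: _]/(_ * _).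
have := mF (w + h *: s) w; rewrite addrAC subrr add0r dotZr !dot_lin => m.
have h0 : h != 0 by near: h; exact: nbhs_dnbhs_neq.
(* Pulling out a square makes the difference quotient nonnegative for either sign of [h]. *)
have -> : h^-1 * (dot s (F (w + h *: s)) - dot s (F w)) =
  h^-1 ^+ 2 * (h * (dot (F (w + h *: s)) s - dot (F w) s)).
  by rewrite !(dotC s); field.
by rewrite mulr_ge0 ?sqr_ge0.
Unshelve. all: by end_near. Qed.

Lemma taylor_bound (L : R) w x : 0 <= L ->
  (forall z z', opnorm (fun u => 'd F z u - 'd F z' u) <= L * enorm (z - z')) ->
  enorm (F x - F w - 'd F w (x - w)) <= L / 2 * enorm (x - w) ^+ 2.
Proof.
move=> L0 lip; move sE : (x - w) => s; move pE : (F x - F w - 'd F w s) => p.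
apply: enorm_le_of_dot; first by rewrite mulr_ge0 ?divr_ge0 ?sqr_ge0.
(* The remainder [p] is paired with itself. With this [k], the Lipschitz bound at [c] is exactly
   [2 * k * c], so the mean value identity gives [dot p p <= k]. *)
pose k := enorm p * (L / 2 * enorm s ^+ 2).
have [c c01] := mvt_quadratic _ _ (dot p ('d F w s)) k (is_derive_dot_line p w s).
move: c01; rewrite in_itv /= => /andP[c0 c1].
rewrite scale1r scale0r addr0 -{1}sE (addrC w) subrK => e.
have lip_c :
    enorm ('d F (w + c *: s) s - 'd F w s) <= L * (c * enorm s) * enorm s.
  apply: le_trans (enorm_le_opnorm _ _ (linear_sub_fun _ _)) _.
  rewrite ler_wpM2r ?enorm_ge0 //.
  apply: le_trans (lip _ _) _; rewrite addrAC subrr add0r enormZ ger0_norm //.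
  exact: ltW.
have := dot_le p ('d F (w + c *: s) s - 'd F w s); rewrite dotDr dotNr => h.
have h2 := ler_wpM2l (enorm_ge0 p) lip_c.
have -> : dot p p = dot p (F x) - dot p (F w) - dot p ('d F w s).
  by rewrite -{2}pE !(dotDr, dotNr).
rewrite mulrC -/k.
rewrite -subr_le0 e subr_le0; apply: le_trans h (le_trans h2 _).
by rewrite le_eqVlt /k; apply/orP; left; apply/eqP; field.
Qed.

End Calculus.

(** * Minty's theorem with a positive definite linear map *)

Section Minty.
Context {R : realType} {d : nat}.
Implicit Types (x y u p : 'rV[R]_d).

Lemma continuous_sumr (T : topologicalType) (I : finType) (f : I -> T -> R) :
  (forall i, continuous (f i)) -> continuous (fun t => \sum_i f i t).
Proof.
by move=> cf t; apply: cvg_big => [|i _]; [exact: add_continuous|exact: cf].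
Qed.

Lemma continuous_mulr (T : topologicalType) (f g : T -> R) :
  continuous f -> continuous g -> continuous (fun t => f t * g t).
Proof. by move=> cf cg t; apply: cvgM; [exact: cf|exact: cg]. Qed.

Lemma continuous_addr (T : topologicalType) (f g : T -> R) :
  continuous f -> continuous g -> continuous (fun t => f t + g t).
Proof. by move=> cf cg t; apply: cvgD; [exact: cf|exact: cg]. Qed.

Lemma closed_preimage (S T : topologicalType) (f : S -> T) (A : set T) :
  continuous f -> closed A -> closed (f @^-1` A).
Proof. by move=> /continuous_closedP; exact. Qed.

Definition simplex n : set 'rV[R]_n :=
  [set l | (forall i, 0 <= l 0 i) /\ \sum_i l 0 i = 1].

Lemma simplex_compact n : compact (simplex n).
Proof.
apply: bounded_closed_compact.
  exists 1; split => // M M1 l [l0 l1] /=; apply: ltW; apply: le_lt_trans M1.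
  rewrite /Num.Def.normr /= mx_normrE; apply/bigmax_leP; split => // -[i j] _ /=.
  rewrite ord1 ger0_norm // -l1 (bigD1 j) //= lerDl; exact: sumr_ge0.
have -> : simplex n =
    (\bigcap_(i in setT) (fun l : 'rV[R]_n => l 0 i) @^-1` [set r | 0 <= r])
    `&` (fun l : 'rV[R]_n => \sum_i l 0 i) @^-1` [set 1].
  apply/seteqP; split => l [h1 h2]; split => // i; last exact: h1.
  by move=> _; exact: h1.
apply: closedI.
  apply: closed_bigI => i _; apply: closed_preimage (@closed_ge R 0).
  exact: coord_continuous.
apply: closed_preimage (@closed_eq R 1).
by apply: continuous_sumr => i; exact: coord_continuous.
Qed.

Lemma ge0_of_affine_ge0 (a b : R) :
  (forall t, 0 < t < 1 -> 0 <= a + t * b) -> 0 <= a.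
Proof.
move=> h; rewrite leNgt; apply/negP => a0.
have ab : 0 < `|a| + `|b| + 1 by have := normr_ge0 a; have := normr_ge0 b; lra.
pose t := `|a| / (`|a| + `|b| + 1) / 2.
have a0' : 0 < `|a| by rewrite normr_gt0 lt_eqF.
have t0 : 0 < t by rewrite !divr_gt0.
have tE : t * (2 * (`|a| + `|b| + 1)) = `|a|.
  by rewrite /t; field; rewrite gt_eqF.
have t1 : t < 1.
  rewrite /t ltr_pdivrMr // ltr_pdivrMr //.
  by have := normr_ge0 b; lra.
have := h t; rewrite t0 t1 => /(_ isT).
have : t * b <= t * `|b| by rewrite ler_pM2l // ler_norm.
have : 0 <= t * `|a| by rewrite mulr_ge0 // ltW.
rewrite ltr0_norm // in tE *; lra.
Qed.

Variables (B : 'M[R]_d) (b : R).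
Hypothesis b0 : 0 < b.
Hypothesis Bpos : forall u, b * dot u u <= dot (u *m B) u.

(** [B] need not be symmetric, but the stationarity equations of the quadratics below involve only
    [B + B^T], which inherits positive definiteness. *)
Lemma sym_unitmx : B + B^T \in unitmx.
Proof.
rewrite -row_free_unit -kermx_eq0; apply/rowV0P => u /sub_kermxP uS.
apply: dot_eq0; have : dot (u *m (B + B^T)) u = 0 by rewrite uS dot0l.
rewrite mulmxDr dotDl [X in _ + X]dotC -dotMl => e.
apply/eqP; rewrite eq_le dot_ge0 andbT -(ler_pM2l b0) mulr0.
by have := Bpos u; lra.
Qed.

Section FiniteFamily.
Variables (n : nat) (xs us : 'I_n -> 'rV[R]_d) (y : 'rV[R]_d).

Let g i x := dot (us i - y + x *m B) (xs i - x).
(** The maximizer of the concave quadratic [g i]. All the [g i] share one quadratic part, so for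
    weights of sum 1 the maximizer [X l] of [L l] is the same combination of the points [xi i]. *)
Let xi i := (xs i *m B^T + y - us i) *m invmx (B + B^T).
Let X (l : 'rV[R]_n) : 'rV[R]_d := \sum_i l 0 i *: xi i.
Let L (l : 'rV[R]_n) x := \sum_i l 0 i * g i x.

Let L_max (l : 'rV[R]_n) x : \sum_i l 0 i = 1 -> L l x <= L l (X l).
Proof.
move=> l1; set p := x - X l.
have xE : x = X l + p by rewrite /p addrC subrK.
(* Stationarity of [L l] at [X l], tested on [p]. The expansion around [X l] is then exact, with
   only [- dot (p *m B) p] left. *)
have stat : \sum_i l 0 i *
    (dot (p *m B) (xs i - X l) - dot (us i - y + X l *m B) p) = 0.
  have XS : \sum_i l 0 i *: (xs i *m B^T + y - us i) - X l *m (B + B^T) = 0.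
    rewrite mulmx_suml -sumrB big1 // => i _.
    by rewrite -scalemxAl -mulmxA mulVmx ?sym_unitmx // mulmx1 subrr.
  rewrite -[RHS](dot0r p) -XS dotDr dotNr dot_sumr.
  rewrite -[X in _ - X]mul1r -l1 mulr_suml -sumrB; apply: eq_bigr => i _.
  by rewrite dotMl mulmxBl (dotC _ p) mulmxDr !dot_lin; ring.
have : L l x = L l (X l) - dot (p *m B) p + 0.
  rewrite -stat -[X in _ - X]mul1r -l1 mulr_suml -sumrB -big_split /=.
  apply: eq_bigr => i _; rewrite /g xE mulmxDl opprD !addrA.
  move: (us i - y + X l *m B) (xs i - X l) (p *m B) => c e q.
  by rewrite !dot_lin; ring.
have : 0 <= dot (p *m B) p.
  by apply: le_trans (Bpos p); rewrite mulr_ge0 ?dot_ge0 // ltW.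
lra.
Qed.

(* [L l x] is concave in [x] with maximizer [X l].  If [l] minimizes the
   maximum over the simplex, moving [l] towards the vertex [i] shows that
   [g i (X l)] is at least the minimal value; and that value is nonnegative by
   evaluating [L l] at the barycenter of [xs], where monotonicity applies. *)
Lemma finite_monotone_extension :
  (0 < n)%N -> (forall i j, 0 <= dot (us i - us j) (xs i - xs j)) ->
  exists x, forall i, 0 <= g i x.
Proof.
move=> n0 mono.
pose c i j k := dot (us i - y + xi j *m B) (xs i - xi k).
(* On the simplex this is the maximal value [L l (X l)], written as a cubic polynomial in [l] so
   that continuity is immediate. *)
pose h (l : 'rV[R]_n) := \sum_i l 0 i * \sum_j l 0 j * \sum_k l 0 k * c i j k.
have hE (l : 'rV[R]_n) : \sum_i l 0 i = 1 -> h l = L l (X l).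
  move=> l1; apply: eq_bigr => i _; rewrite /g; congr (_ * _).
  have -> : us i - y + X l *m B = \sum_j l 0 j *: (us i - y + xi j *m B).
    rewrite -[us i - y]scale1r -{1}l1 scaler_suml mulmx_suml -big_split /=.
    by apply: eq_bigr => j _; rewrite [RHS]scalerDr scalemxAl scale1r.
  have -> : xs i - X l = \sum_k l 0 k *: (xs i - xi k).
    rewrite -[xs i]scale1r -{1}l1 scaler_suml -sumrB.
    by apply: eq_bigr => k _; rewrite [RHS]scalerBr scale1r.
  rewrite dot_suml; apply: eq_bigr => j _; rewrite dotZl; congr (_ * _).
  by rewrite dot_sumr; apply: eq_bigr => k _; rewrite dotZr.
have cont_h : continuous h.
  do 3 (apply: continuous_sumr => ?; apply: continuous_mulr;
    first exact: coord_continuous).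
  by move=> l; exact: cst_continuous.
have simplex_vertex i : simplex n (delta_mx 0 i).
  split=> [j|]; first by rewrite mxE eqxx; exact: ler0n.
  rewrite (bigD1 i) //= mxE !eqxx big1 ?addr0 // => j /negbTE ji.
  by rewrite mxE eqxx ji.
have [||l /set_mem [l0 l1] lmin] :=
  @compact_EVT_min _ _ h _ _ (simplex_compact n).
- by exists (delta_mx 0 (Ordinal n0)).
- exact: continuous_subspaceT.
have hl0 : 0 <= h l.
  rewrite (hE _ l1); pose m := \sum_i l 0 i *: xs i.
  apply: le_trans (L_max l m l1).
  have bar q : dot q (\sum_i l 0 i *: (xs i - m)) = 0.
    suff -> : \sum_i l 0 i *: (xs i - m) = 0 by rewrite dot0r.
    under eq_bigr do rewrite scalerBr.
    by rewrite sumrB -scaler_suml l1 scale1r subrr.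
  have -> : L l m = \sum_i \sum_j l 0 i * l 0 j * dot (us i) (xs i - xs j).
    have -> : L l m = \sum_i l 0 i * dot (us i) (xs i - m)
        + dot (m *m B - y) (\sum_i l 0 i *: (xs i - m)).
      rewrite dot_sumr -big_split /=; apply: eq_bigr => i _.
      by rewrite /g dotZr -addrA (addrC (- y)) dotDl mulrDr.
    rewrite bar addr0; apply: eq_bigr => i _.
    rewrite -[xs i]scale1r -{1}l1 scaler_suml -sumrB dot_sumr mulr_sumr.
    by apply: eq_bigr => j _; rewrite scale1r -scalerBr dotZr mulrA.
  set S := \sum_i _.
  (* Exchanging the two indices in one copy of [S] produces the differences to which monotonicity
     applies. *)
  have S2 : S + S = \sum_i \sum_j l 0 i * l 0 j * dot (us i - us j) (xs i - xs j).
    rewrite {2}/S exchange_big -big_split /=; apply: eq_bigr => i _.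
    rewrite -big_split /=; apply: eq_bigr => j _.
    by rewrite !dot_lin; ring.
  have : 0 <= S + S.
    rewrite S2; apply: sumr_ge0 => i _; apply: sumr_ge0 => j _.
    by rewrite !mulr_ge0.
  lra.
(* Along the segment from [X l] to [xi i], [g i] is this affine function of [t] minus
   [t ^+ 2 * dot (q *m B) q]. That last term is nonnegative, so the affine part is at least
   [g i (X lt)]. *)
exists (X l) => i; apply: (@ge0_of_affine_ge0 _
  (dot (us i - y + X l *m B) (X l - xi i)
   + dot ((xi i - X l) *m B) (xs i - X l))).
move=> t /andP[t0 t1].
pose e : 'rV[R]_n := delta_mx 0 i.
have ei : e 0 i = 1 by rewrite mxE !eqxx.
have ej j : j != i -> e 0 j = 0 by move=> /negbTE ji; rewrite mxE ji andbF.
have [v0 v1] := simplex_vertex i; rewrite -/e in v0 v1; clearbody e.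
pose lt := (1 - t) *: l + t *: e.
have ltE j : lt 0 j = (1 - t) * l 0 j + t * e 0 j by rewrite !mxE.
clearbody lt.
have ltD : simplex n lt.
  split=> [j|]; first by rewrite ltE addr_ge0 // mulr_ge0 // ?subr_ge0 ltW.
  by under eq_bigr do rewrite ltE; rewrite big_split /= -!mulr_sumr l1 v1; ring.
have XE : X lt = X l + t *: (xi i - X l).
  have -> : X lt = (1 - t) *: X l + t *: \sum_j e 0 j *: xi j.
    rewrite !scaler_sumr -big_split /=; apply: eq_bigr => j _.
    by rewrite ltE !scalerA -scalerDl.
  rewrite (bigD1 i) //= ei scale1r big1 ?addr0 => [|j /ej ->].
    by rewrite scalerBl scale1r scalerBr addrAC -addrA.
  by rewrite scale0r.
have LE : L lt (X lt) = (1 - t) * L l (X lt) + t * g i (X lt).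
  have -> : t * g i (X lt) = t * \sum_j e 0 j * g j (X lt).
    by rewrite (bigD1 i) //= ei mul1r big1 ?addr0 // => j /ej ->; rewrite mul0r.
  rewrite !mulr_sumr -big_split /=; apply: eq_bigr => j _.
  by rewrite ltE; ring.
have gi : 0 <= g i (X lt).
  have := lmin lt (mem_set ltD); rewrite (hE _ ltD.2) LE => hl.
  have := L_max l (X lt) l1; rewrite -(hE _ l1) => hl2.
  have t1' : 0 < 1 - t by rewrite subr_gt0.
  have := ler_wpM2l (ltW t1') hl2 => hl3.
  rewrite -(pmulr_rge0 _ t0); apply: le_trans (_ : t * h l <= _); last by lra.
  by rewrite mulr_ge0 // ltW.
move: gi; rewrite /g XE; set q := xi i - X l.
have -> : X l - xi i = - q by rewrite opprB.
rewrite mulmxDl -scalemxAl opprD !addrA.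
have := mulr_ge0 (ltW b0) (dot_ge0 q) => bq.
have qB := le_trans bq (Bpos q); clearbody q.
move: qB; move: (us i - y + X l *m B) (xs i - X l) (q *m B) => a0 a1 a2 qB.
rewrite !dot_lin => gi.
have := mulr_ge0 (sqr_ge0 t) qB.
by move: gi; lra.
Qed.

End FiniteFamily.
(** The points [x] for which [(x, y - x *m B)] is monotonically related to [q]. Positive
    definiteness of [B] makes this a bounded set, hence the compactness below. *)
Let halfspace y (q : 'rV[R]_d * 'rV[R]_d) : set 'rV[R]_d :=
  [set x | 0 <= dot (q.2 - y + x *m B) (q.1 - x)].

Let halfspace_closed y q : closed (halfspace y q).
Proof.
apply: closed_preimage (@closed_ge R 0); rewrite /dot.
apply: continuous_sumr => i; apply: continuous_mulr.
  have -> : (fun x : 'rV[R]_d => (q.2 - y + x *m B) ord0 i)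
      = (fun x => (q.2 - y) ord0 i + \sum_j x ord0 j * B j i).
    by apply/funext => x; rewrite mxE [X in _ + X]mxE.
  apply: continuous_addr; first by move=> ?; exact: cst_continuous.
  apply: continuous_sumr => j; apply: continuous_mulr.
    exact: coord_continuous.
  by move=> ?; exact: cst_continuous.
have -> : (fun x : 'rV[R]_d => (q.1 - x) ord0 i)
    = (fun x => q.1 ord0 i + -1 * x ord0 i).
  by apply/funext => x; rewrite mxE [X in _ + X]mxE mulN1r.
apply: continuous_addr; first by move=> ?; exact: cst_continuous.
apply: continuous_mulr; first by move=> ?; exact: cst_continuous.
exact: coord_continuous.
Qed.

Let halfspace_compact y q : compact (halfspace y q).
Proof.
apply: bounded_closed_compact; last exact: halfspace_closed.
pose r := enorm (q.2 - y + q.1 *m B) / b + enorm q.1.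
exists r; split; first exact: num_real.
move=> M rM x hx /=; apply: ltW; apply: le_lt_trans rM.
apply: (@le_trans _ _ (enorm x)).
  rewrite /Num.Def.normr /= mx_normrE; apply/bigmax_leP.
  by split => [|[i j] _ /=]; rewrite ?enorm_ge0 // ord1 coord_le_enorm.
have -> : x = (x - q.1) + q.1 by rewrite subrK.
apply: le_trans (ler_enormD _ _) _; rewrite lerD2r.
move pE : (x - q.1) => p.
have xE : x = q.1 + p by rewrite -pE addrC subrK.
apply: enorm_le_of_dot; first by rewrite divr_ge0 ?enorm_ge0 // ltW.
have : 0 <= dot (q.2 - y + x *m B) (q.1 - x) := hx.
rewrite xE opprD (addrA q.1 (- q.1)) subrr add0r mulmxDl addrA dotNr dotDl => h.
have := Bpos p; have := dot_le (q.2 - y + q.1 *m B) (- p).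
rewrite dotNr enormN => h1 h2.
rewrite -(ler_pM2l b0).
have -> : b * (enorm (q.2 - y + q.1 *m B) / b * enorm p)
    = enorm (q.2 - y + q.1 *m B) * enorm p by field; rewrite gt_eqF.
lra.
Qed.

(** Finitely many of the compact sets [halfspace y q] meet by [finite_monotone_extension], hence all
    of them do. A common point [x] extends the graph of [H] monotonically by [(x, y - x *m B)], and
    maximality puts this pair in the graph. *)
Lemma minty_posdef (H : 'rV[R]_d -> set 'rV[R]_d) y :
  maximally_monotone H -> (exists q, domain H q) ->
  exists x, H x (y - x *m B).
Proof.
move=> [mono maxi] [x0 [u0 Hx0]].
pose D := [set q : 'rV[R]_d * 'rV[R]_d | H q.1 q.2].
have cpt := halfspace_compact y (x0, u0); rewrite compact_In0 in cpt.
have [||x hx] := cpt _ D (fun q => halfspace y (x0, u0) `&` halfspace y q).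
- by exists (halfspace y) => // q _; exact: halfspace_closed.
- move=> D' D'D.
  (* The fixed pair keeps the family nonempty and provides the compact set in which the intersection
     is taken. *)
  pose s := (x0, u0) :: enum_fset D'.
  have sH q : q \in s -> H q.1 q.2.
    rewrite in_cons => /orP[/eqP -> //|qD].
    exact/set_mem/D'D.
  pose sn (i : 'I_(size s)) := nth (x0, u0) s i.
  have snH i : H (sn i).1 (sn i).2 by apply: sH; rewrite mem_nth.
  have [//|i j|x hx] := @finite_monotone_extension _
    (fun i => (sn i).1) (fun i => (sn i).2) y.
    exact: mono.
  have hs q : q \in s -> halfspace y q x.
    move=> qs; have qi : (index q s < size s)%N by rewrite index_mem.
    by have := hx (Ordinal qi); rewrite /sn /= nth_index.
  exists x => q /= qD; split; first by apply: hs; rewrite mem_head.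
  by apply: hs; rewrite in_cons; apply/orP; right.
exists x.
pose G z := [set u | H z u \/ (z = x /\ u = y - x *m B)].
have rel z u : H z u -> 0 <= dot (u - (y - x *m B)) (z - x).
  move=> Hzu; have [_] := hx (z, u) Hzu.
  by rewrite /halfspace /= opprB addrA addrAC.
apply: (maxi G) => [z w u v|z u Hzu|]; last by right.
- move=> [Hz|[-> ->]] [Hw|[-> ->]]; [exact: mono|exact: rel| |].
  + by have := rel _ _ Hw; rewrite -(opprB v) -(opprB w) dotNl dotNr opprK.
  + by rewrite subrr dot0l.
- by left.
Qed.

End Minty.

(** * The line search *)

Lemma sqrt2_bounds (R : realType) : 7 / 5 <= (Num.sqrt 2 : R) <= 57 / 40.
Proof.
by apply/andP; split; rewrite -(@ler_pXn2r _ 2) ?nnegrE ?sqrtr_ge0 ?divr_ge0 //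
  sqr_sqrtr //; lra.
Qed.

Section Estimates.
Context {R : realType} {d : nat}.
Implicit Types (c x y e G P Q : 'rV[R]_d).

(* [P] and [Q] are the values of one model at [x] and [x'], and [P'] is the
   value at [x'] of another; [a' = a] and [c' = x' = zs] compares with the
   solution [zs]. *)
Lemma resolvent_stability (a a' : R) c c' x x' P P' Q :
  0 < a' -> a' <= a ->
  0 <= dot ((a^-1 *: (c - x) - P) - (a'^-1 *: (c' - x') - P')) (x - x') ->
  0 <= dot (P - Q) (x - x') ->
  enorm (x - x') <=
    enorm (c - c') + (a - a') / a' * enorm (c' - x') + a * enorm (Q - P').
Proof.
move=> a'0 aa' h mono; have a0 := lt_le_trans a'0 aa'.
have r0 : 0 <= (a - a') / a' by rewrite divr_ge0 ?subr_ge0 // ltW.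
apply: enorm_le_of_dot.
  by rewrite !addr_ge0 ?enorm_ge0 // mulr_ge0 ?enorm_ge0 // ltW.
have := mulr_ge0 (ltW a0) h; have := mulr_ge0 (ltW a0) mono.
move xE : (x - x') => p; have -> : x = x' + p by rewrite -xE addrC subrK.
have b1 := dot_le (c - c') p.
have b2 := ler_wpM2l r0 (dot_le (- (c' - x')) p).
have b3 := ler_wpM2l (ltW a0) (dot_le (- (Q - P')) p).
rewrite enormN in b2; rewrite enormN in b3.
move: b1 b2 b3; rewrite !dot_lin => b1 b2 b3 m1 m2.
have e1 t : a * (a^-1 * t) = t by rewrite mulrA divff ?mul1r ?gt_eqF.
have e2 t : a * (a'^-1 * t) = (a - a') / a' * t + t by field; rewrite gt_eqF.
move: m2; rewrite !(mulrDr, mulrN) !e1 !e2 => m2.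
lra.
Qed.

(* Multiplied by [t], the difference of the two sides is
   [- (1 - t) B <G' - G, x' - x> + <e, q> - t |q|^2 / 2] with
   [q = B G' - (1 - t) B G], and the bound on [e] says exactly that
   [2 t <e, q> <= t^2 |q|^2 - |e|^2]. *)
Lemma potential_decrease (t B : R) x x' G G' e :
  0 < t -> t <= 1 -> 0 <= B ->
  x' = (1 - t) *: x - (t * B) *: G' + e ->
  0 <= dot (G' - G) (x' - x) ->
  2 * dot e e <= dot (e - t *: (B *: G' - ((1 - t) * B) *: G))
                     (e - t *: (B *: G' - ((1 - t) * B) *: G)) ->
  B ^+ 2 / 2 * dot G' G' + B * dot G' x' <=
    ((1 - t) * B) ^+ 2 / 2 * dot G G + (1 - t) * B * dot G x.
Proof.
move=> t0 t1 B0 -> m err.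
have m' : 0 <= (1 - t) * B * dot (G' - G) ((1 - t) *: x - (t * B) *: G' + e - x).
  by rewrite mulr_ge0 // mulr_ge0 // subr_ge0.
have dec : 0 <= t ^+ 2 * (((1 - t) * B) ^+ 2 / 2 * dot G G + (1 - t) * B * dot G x
    - (B ^+ 2 / 2 * dot G' G' + B * dot G' ((1 - t) *: x - (t * B) *: G' + e))).
  have := mulr_ge0 (ltW t0) m'; have := dot_ge0 e; move: err.
  rewrite !dot_lin (dotC G G') (dotC e G') (dotC e G); lra.
by rewrite -subr_ge0 -(pmulr_rge0 _ (exprn_gt0 2 t0)).
Qed.

End Estimates.

(** * Trial points and the invariants of the outer iteration *)

Section Iterates.
Context {R : realType} {d : nat}.
Variables (F : 'rV[R]_d -> 'rV[R]_d) (H : 'rV[R]_d -> set 'rV[R]_d).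
Variables (L2 eps : R) (zs z0 : 'rV[R]_d).
Hypothesis L2_gt0 : 0 < L2.
Hypothesis eps_gt0 : 0 < eps.
Hypothesis F_mono : monotone_map F.
Hypothesis F_diff : forall z, differentiable F z.
Hypothesis F_lip :
  forall z z', opnorm (fun u => 'd F z u - 'd F z' u) <= L2 * enorm (z - z').
Hypothesis H_max : maximally_monotone H.
Hypothesis H_zs : H zs (- F zs).
Hypothesis H_z0 : domain H z0.
Implicit Types (s : state R d) (a : R) (w x y z : 'rV[R]_d).

Definition linearization w y : 'rV[R]_d := F w + 'd F w (y - w).

Lemma linearization_mono w x y :
  0 <= dot (linearization w x - linearization w y) (x - y).
Proof.
rewrite /linearization; have := @monotone_diff_ge0 _ _ F F_diff w (x - y) F_mono.
move: (F w) ('d F w) => b f.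
suff -> : b + f (x - w) - (b + f (y - w)) = f (x - y) by [].
by rewrite opprD addrACA subrr add0r -linearB opprB addrA subrK.
Qed.

Lemma linearization_error w x :
  enorm (F x - linearization w x) <= L2 / 2 * enorm (x - w) ^+ 2.
Proof.
by rewrite /linearization opprD addrA; apply: taylor_bound => //; exact: ltW.
Qed.

(** The difference splits into the Taylor error of the model at [w'], evaluated at [w], and the
    difference of the two derivatives applied to [y - w]. *)
Lemma linearization_lip w w' y :
  enorm (linearization w y - linearization w' y) <=
    L2 / 2 * enorm (w - w') ^+ 2 + L2 * enorm (w - w') * enorm (y - w).
Proof.
have h1 := enorm_le_opnorm _ (y - w) (linear_sub_fun ('d F w) ('d F w')).
have h2 := le_trans h1 (ler_wpM2r (enorm_ge0 _) (F_lip w w')).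
have h3 := linearization_error w' w.
move: h2 h3; rewrite /linearization.
move: (F w) (F w') ('d F w) ('d F w') => p q f g h2 h3.
have -> : p + f (y - w) - (q + g (y - w')) =
    (p - (q + g (w - w'))) + (f (y - w) - g (y - w)).
  have -> : y - w' = (w - w') + (y - w) by rewrite [RHS]addrC addrA subrK.
  by rewrite (linearD g); apply/rowP => i; rewrite !mxE; ring.
by apply: le_trans (ler_enormD _ _) _; exact: lerD.
Qed.

Lemma H_mono x y u v : H x u -> H y v -> 0 <= dot (u - v) (x - y).
Proof. exact: H_max.1. Qed.

Lemma solution_inclusion s a x : 0 < a -> solves_inclusion F H z0 s a x ->
  H x (a^-1 *: (anchor z0 s a - x) - linearization (zhalf F z0 s a) x).
Proof.
move=> a0 [w Hw e]; suff -> : a^-1 *: (anchor z0 s a - x) -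
  linearization (zhalf F z0 s a) x = w by [].
move: e; rewrite -[model _ _ _ _ _]/(linearization (zhalf F z0 s a) x).
move: (linearization _ x) (anchor z0 s a) => P c e.
have -> : c = a *: P + a *: w + x.
  by apply/eqP; rewrite -subr_eq0 -oppr_eq0 opprB -e.
by rewrite addrK scalerDr !scalerA mulVf ?gt_eqF // !scale1r addrC addKr.
Qed.

(** With [a = a'] this gives uniqueness of the trial point; with the two ends of a bracket it
    controls how far the trial point moves. *)
Lemma trial_stability s a a' x x' : 0 < a' -> a' <= a ->
  H x (a^-1 *: (anchor z0 s a - x) - linearization (zhalf F z0 s a) x) ->
  H x' (a'^-1 *: (anchor z0 s a' - x') - linearization (zhalf F z0 s a') x') ->
  enorm (x - x') <= enorm (anchor z0 s a - anchor z0 s a')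
    + (a - a') / a' * enorm (anchor z0 s a' - x')
    + a * enorm (linearization (zhalf F z0 s a) x'
                 - linearization (zhalf F z0 s a') x').
Proof.
move=> a'0 aa' h h'; apply: resolvent_stability => //; first exact: H_mono h h'.
exact: linearization_mono.
Qed.

Lemma trial_exists s a : 0 < a -> exists x, trial F H z0 s a x.
Proof.
move=> a0; pose w := zhalf F z0 s a.
pose B : 'M[R]_d := (a^-1)%:M + lin1_mx ('d F w).
have BE x : x *m B = a^-1 *: x + 'd F w x.
  by rewrite mulmxDr mul_mx_scalar mul_rV_lin1.
have ai0 : 0 < a^-1 by rewrite invr_gt0.
have Bpos x : a^-1 * dot x x <= dot (x *m B) x.
  by rewrite BE dotDl dotZl lerDl; exact: monotone_diff_ge0.
have [x] := minty_posdef B a^-1 ai0 Bpos H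
  (a^-1 *: anchor z0 s a - F w + 'd F w w) H_max (ex_intro _ z0 H_z0).
have -> : a^-1 *: anchor z0 s a - F w + 'd F w w - x *m B =
    a^-1 *: (anchor z0 s a - x) - linearization w x.
  rewrite BE /linearization; move: (F w) (anchor z0 s a) ('d F w) => p c f.
  by rewrite (linearB f) scalerBr; apply/rowP => i; rewrite !mxE; ring.
move=> Hx; exists x; split.
  exists (a^-1 *: (anchor z0 s a - x) - linearization w x) => //.
  rewrite -[model _ _ _ _ _]/(linearization w x).
  move: (linearization w x) (anchor z0 s a) => P c.
  by rewrite -scalerDr (addrC P) subrK scalerA divff ?gt_eqF // scale1r
    subrK subrr.
move=> x' /(solution_inclusion _ _ _ a0) Hx'.
apply/eqP; rewrite -subr_eq0; apply/eqP/enorm_eq0/eqP.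
rewrite eq_le enorm_ge0 andbT.
have := trial_stability s a a x x' a0 (lexx _) Hx Hx'.
by rewrite !subrr enorm0 !mul0r mulr0 !addr0.
Qed.

Notation D := (enorm (z0 - zs)).
Notation G s := (F (st_z s) + st_v s).

Let D_ge0 : 0 <= D. Proof. exact: enorm_ge0. Qed.

(* [lra] compares its atoms up to conversion, which is slow on norms of vectors. *)
Ltac local_lra :=
  repeat match goal with |- context [enorm ?x] => generalize (enorm x); intro end;
  clear -L2_gt0 eps_gt0 F_mono F_diff F_lip H_max H_zs H_z0 D_ge0; lra.

(* The Lyapunov function of the anchored iteration: it vanishes at the initial
   state and every accepted step decreases it. *)
Definition potential s : R :=
  st_A s ^+ 2 / 2 * dot (G s) (G s) + st_A s * dot (G s) (st_z s - z0).

(** The invariant of reached states. The constant 11 reproduces itself: with [t] the anchor weight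
    [ratio s a], a step gives at most [t * D + (1 - t) * (11 * D)] from the anchor and
    [10 * (t * D)] from the model error. *)
Definition good s : Prop :=
  [/\ 0 <= st_A s, H (st_z s) (st_v s), potential s <= 0
    & enorm (st_z s - zs) <= 11 * D].

Lemma FH_mono x y u v : H x u -> H y v ->
  0 <= dot ((F x + u) - (F y + v)) (x - y).
Proof.
by move=> Hx Hy; rewrite opprD addrACA dotDl addr_ge0 ?F_mono ?H_mono.
Qed.

Lemma FH_zs x u : H x u -> 0 <= dot (F x + u) (x - zs).
Proof. by move=> Hx; have := FH_mono _ _ _ _ Hx H_zs; rewrite subrr subr0. Qed.

(** Monotonicity at [zs] bounds the inner product in the potential below by [- enorm (G s) * D]; a
    nonpositive potential then compares the square of [A |G|] with [2 * D] times it. *)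
Lemma A_residual_le s : 0 <= st_A s -> H (st_z s) (st_v s) -> potential s <= 0 ->
  st_A s * residual F s <= 2 * D.
Proof.
move=> A0 Hz; rewrite /potential /residual -enorm_sqr.
have := FH_zs _ _ Hz; have := dot_le (G s) (z0 - zs).
have -> : dot (G s) (st_z s - z0) = dot (G s) (st_z s - zs) - dot (G s) (z0 - zs).
  by rewrite -dotNr -dotDr opprB addrA subrK.
move: (dot _ (st_z s - zs)) (dot _ (z0 - zs)) => p q.
have := enorm_ge0 (G s); move: (enorm (G s)) (st_A s) A0 => r A A0 r0 h1 h2 h3.
have [->|Ar0] := eqVneq (A * r) 0; first by rewrite mulr_ge0.
have Arp : 0 < A * r by rewrite lt_neqAle eq_sym Ar0 mulr_ge0.
rewrite -(ler_pM2l Arp).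
have := ler_wpM2l A0 h1; have := mulr_ge0 A0 h2; lra.
Qed.

Definition ratio s a : R := a / (st_A s + a).

Lemma ratio_bounds s a : 0 <= st_A s -> 0 < a ->
  [/\ 0 < ratio s a, ratio s a <= 1, st_A s / (st_A s + a) = 1 - ratio s a,
      ratio s a * (st_A s + a) = a & (1 - ratio s a) * (st_A s + a) = st_A s].
Proof.
move=> A0 a0; have Aa : 0 < st_A s + a by lra.
rewrite /ratio; split.
- exact: divr_gt0.
- by rewrite ler_pdivrMr // mul1r lerDr.
- by field; rewrite gt_eqF.
- by rewrite divfK ?gt_eqF.
- by field; rewrite gt_eqF.
Qed.

Lemma anchorE s a : 0 <= st_A s -> 0 < a ->
  anchor z0 s a = z0 + (1 - ratio s a) *: (st_z s - z0).
Proof.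
move=> A0 a0; have [_ _ e _ _] := ratio_bounds s a A0 a0.
rewrite /anchor e -/(ratio s a); apply/rowP => i; rewrite !mxE; ring.
Qed.

Lemma zhalfE s a : 0 <= st_A s -> 0 < a ->
  zhalf F z0 s a = anchor z0 s a - (ratio s a * st_A s) *: G s.
Proof.
move=> A0 a0; have [_ _ e e1 e2] := ratio_bounds s a A0 a0.
rewrite /zhalf /anchor e -/(ratio s a); move: (G s) => g.
have -> : ratio s a * st_A s = (1 - ratio s a) * a by move: e1; lra.
apply/rowP => i; rewrite !mxE; ring.
Qed.

Lemma anchor_dist_convex s a : 0 <= st_A s -> 0 < a ->
  enorm (anchor z0 s a - zs) <=
    ratio s a * D + (1 - ratio s a) * enorm (st_z s - zs).
Proof.
move=> A0 a0; have [t0 t1 _ _ _] := ratio_bounds s a A0 a0.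
have -> : anchor z0 s a - zs =
    ratio s a *: (z0 - zs) + (1 - ratio s a) *: (st_z s - zs).
  by rewrite anchorE //; apply/rowP => i; rewrite !mxE; ring.
apply: le_trans (ler_enormD _ _) _.
by rewrite !enormZ !ger0_norm ?subr_ge0 // ltW.
Qed.

Lemma good_next s a x : 0 < a -> good s -> trial F H z0 s a x ->
  merit F z0 L2 s a x <= Num.sqrt 2 -> good (Defs.next F z0 s a x).
Proof.
move=> a0 [A0 Hz V0 dz] tr mer.
have Hx := solution_inclusion _ _ _ a0 tr.1.
have Ap0 : 0 <= st_A s + a by lra.
have [t0 t1 _ tA tA'] := ratio_bounds s a A0 a0.
have wE := zhalfE s a A0 a0; have cE := anchorE s a A0 a0.
have res := A_residual_le s A0 Hz V0.
(* The scaled model error, through which the step becomes an implicit step for [F + H] perturbed by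
   [e]. Taylor's bound and the merit bound give the factor [Num.sqrt 2 / 2], just what
   [potential_decrease] requires. *)
pose e := a *: (F x - linearization (zhalf F z0 s a) x).
have e_le : enorm e <= Num.sqrt 2 / 2 * enorm (x - zhalf F z0 s a).
  rewrite enormZ gtr0_norm //.
  apply: le_trans (ler_wpM2l (ltW a0) (linearization_error _ _)) _.
  have := ler_wpM2r (enorm_ge0 (x - zhalf F z0 s a)) mer; rewrite /merit; lra.
have e2_le : 2 * dot e e <= dot (x - zhalf F z0 s a) (x - zhalf F z0 s a).
  rewrite -!enorm_sqr.
  have s2 : Num.sqrt 2 ^+ 2 = 2 :> R by rewrite sqr_sqrtr.
  have : enorm e ^+ 2 <= (Num.sqrt 2 / 2 * enorm (x - zhalf F z0 s a)) ^+ 2.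
    by rewrite ler_pXn2r ?nnegrE ?mulr_ge0 ?enorm_ge0 ?divr_ge0 ?sqrtr_ge0.
  rewrite exprMn expr_div_n s2; lra.
pose v := a^-1 *: (anchor z0 s a - x) - linearization (zhalf F z0 s a) x.
pose G' := F x + v.
have xE : x = anchor z0 s a - a *: G' + e.
  rewrite /G' /v /e; move: (linearization _ x) (anchor z0 s a) (F x) => P c f.
  have ac : a *: (a^-1 *: (c - x)) = c - x.
    by rewrite scalerA divff ?gt_eqF // scale1r.
  rewrite addrA scalerBr scalerDr ac; apply/rowP => i; rewrite !mxE; ring.
clearbody e.
have x0E : x - z0 = (1 - ratio s a) *: (st_z s - z0)
    - (ratio s a * (st_A s + a)) *: G' + e.
  by rewrite {1}xE tA cE; apply/rowP => i; rewrite !mxE; ring.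
have xwE : x - zhalf F z0 s a = e - ratio s a *: ((st_A s + a) *: G'
    - ((1 - ratio s a) * (st_A s + a)) *: G s).
  rewrite {1}xE wE tA' scalerBr !scalerA tA.
  by move: (G s) (anchor z0 s a) => g c; apply/rowP => i; rewrite !mxE; ring.
have HG : 0 <= dot (G' - G s) ((x - z0) - (st_z s - z0)).
  by rewrite opprB addrA subrK; exact: FH_mono.
rewrite xwE in e2_le.
have dec := potential_decrease _ _ _ _ _ _ _ t0 t1 Ap0 x0E HG e2_le.
have V' : potential (Defs.next F z0 s a x) <= 0.
  by apply: le_trans dec _; rewrite tA'.
have A'0 : 0 <= st_A (Defs.next F z0 s a x) by [].
have H' : H (st_z (Defs.next F z0 s a x)) (st_v (Defs.next F z0 s a x)) by [].
split=> //=.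
have res' : (st_A s + a) * enorm G' <= 2 * D.
  exact: (A_residual_le _ A'0 H' V').
(* The error is bounded by itself: [|e| <= 57/80 (|e| + 4 t D)] with [t = ratio s a], and 57/80 is
   below 1, so [|e|] can be absorbed on the left: 228/23 is below 10. *)
have e_small : enorm e <= 10 * (ratio s a * D).
  have q_le : enorm ((st_A s + a) *: G'
      - ((1 - ratio s a) * (st_A s + a)) *: G s) <= 4 * D.
    apply: le_trans (ler_enormB _ _) _; rewrite tA' !enormZ !ger0_norm //.
    by move: res res'; rewrite /residual; lra.
  rewrite xwE in e_le; move: q_le e_le; move: (_ *: G' - _) => q q_le e_le.
  have := ler_enormB e (ratio s a *: q).
  rewrite enormZ (gtr0_norm t0) => h.
  have h' := ler_wpM2l (ltW t0) q_le.
  have /andP[_ s2] := sqrt2_bounds R.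
  have s3 : Num.sqrt 2 / 2 * enorm (e - ratio s a *: q) <=
      57 / 80 * (enorm e + 4 * (ratio s a * D)).
    apply: ler_pM; rewrite ?divr_ge0 ?sqrtr_ge0 ?enorm_ge0 //; first by lra.
    by apply: le_trans h _; rewrite lerD2l; lra.
  by have := mulr_ge0 (ltW t0) D_ge0; move: (le_trans e_le s3); lra.
have c_le := anchor_dist_convex s a A0 a0.
have t1' : 0 <= 1 - ratio s a by rewrite subr_ge0.
have dz' := ler_wpM2l t1' dz.
(* Pairing the implicit step with [x - zs] lets monotonicity discard the [G'] term. *)
have : enorm (x - zs) <= enorm (anchor z0 s a - zs) + enorm e.
  apply: enorm_le_of_dot; first by rewrite addr_ge0 ?enorm_ge0.
  have -> : dot (x - zs) (x - zs) =
      dot (anchor z0 s a - zs) (x - zs) - a * dot G' (x - zs) + dot e (x - zs).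
    rewrite -dotZl -dotNl -!dotDl; congr dot.
    by rewrite {1}xE; apply/rowP => i; rewrite !mxE; ring.
  have := mulr_ge0 (ltW a0) (FH_zs _ _ Hx).
  have := dot_le e (x - zs); have := dot_le (anchor z0 s a - zs) (x - zs).
  rewrite -/v -/G'; lra.
by move: e_small c_le dz'; lra.
Qed.

Lemma anchor_dist s a : 0 < a -> good s -> enorm (anchor z0 s a - zs) <= 11 * D.
Proof.
move=> a0 [A0 _ _ dz]; have [t0 t1 _ _ _] := ratio_bounds s a A0 a0.
apply: le_trans (anchor_dist_convex s a A0 a0) _.
have t1' : 0 <= 1 - ratio s a by rewrite subr_ge0.
by have := ler_wpM2l t1' dz; have := mulr_ge0 (ltW t0) D_ge0; lra.
Qed.

Lemma zhalf_anchor_dist s a : 0 < a -> good s ->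
  enorm (zhalf F z0 s a - anchor z0 s a) <= 2 * D.
Proof.
move=> a0 [A0 Hz V0 _]; have [t0 t1 _ _ _] := ratio_bounds s a A0 a0.
rewrite zhalfE // addrAC subrr add0r enormN enormZ.
rewrite ger0_norm; last by apply: mulr_ge0 => //; exact: ltW.
apply: le_trans (A_residual_le s A0 Hz V0); rewrite -mulrA ler_piMl //.
by rewrite mulr_ge0 ?enorm_ge0.
Qed.

(** The solution [zs] is its own resolvent point for the anchor [zs], so stability applies. The 11
    is the anchor distance, and 85 dominates [13^2 / 2], the Taylor error of the model at [zs]. *)
Lemma trial_dist s a x : 0 < a -> good s -> trial F H z0 s a x ->
  enorm (x - zs) <= D * (11 + 85 * (L2 * a * D)).
Proof.
move=> a0 gs tr; have Hx := solution_inclusion _ _ _ a0 tr.1.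
have dc := anchor_dist s a a0 gs; have dw := zhalf_anchor_dist s a a0 gs.
have dwz : enorm (zs - zhalf F z0 s a) <= 13 * D.
  rewrite enormBC; apply: le_trans (ler_enormD_via (anchor z0 s a) _ _) _; lra.
have := resolvent_stability a a (anchor z0 s a) zs x zs
  (linearization (zhalf F z0 s a) x) (F zs) (linearization (zhalf F z0 s a) zs)
  a0 (lexx _).
rewrite !subrr scaler0 sub0r => /(_ (H_mono _ _ _ _ Hx H_zs)).
move=> /(_ (linearization_mono _ _ _)); rewrite !mul0r addr0 => h.
apply: le_trans h _; rewrite (enormBC (linearization _ _)).
have := linearization_error (zhalf F z0 s a) zs.
have sq : enorm (zs - zhalf F z0 s a) ^+ 2 <= (13 * D) ^+ 2.
  by rewrite ler_pXn2r ?nnegrE ?enorm_ge0 // mulr_ge0.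
have L2h : 0 <= L2 / 2 by rewrite divr_ge0 // ltW.
move=> /le_trans /(_ (ler_wpM2l L2h sq)) err.
have := ler_wpM2l (ltW a0) err.
have := mulr_ge0 (mulr_ge0 (ltW L2_gt0) (ltW a0)) (sqr_ge0 D); lra.
Qed.

Lemma trial_anchor_dist s a x : 0 < a -> good s -> trial F H z0 s a x ->
  enorm (anchor z0 s a - x) <= D * (22 + 85 * (L2 * a * D)).
Proof.
move=> a0 gs tr; apply: le_trans (ler_enormD_via zs _ _) _.
rewrite (enormBC zs); have := trial_dist s a x a0 gs tr.
by have := anchor_dist s a a0 gs; lra.
Qed.

Lemma trial_zhalf_dist s a x : 0 < a -> good s -> trial F H z0 s a x ->
  enorm (x - zhalf F z0 s a) <= D * (24 + 85 * (L2 * a * D)).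
Proof.
move=> a0 gs tr; apply: le_trans (ler_enormD_via (anchor z0 s a) _ _) _.
rewrite (enormBC x) (enormBC _ (zhalf _ _ _ _)).
have := trial_anchor_dist s a x a0 gs tr.
by have := zhalf_anchor_dist s a a0 gs; lra.
Qed.

(** For [t] below 1/30 the merit bound [t (24 + 85 t)] is still less than 1. *)
Lemma merit_ge1_step s a x : 0 < a -> good s -> trial F H z0 s a x ->
  1 <= merit F z0 L2 s a x -> 1 <= 30 * (L2 * a * D).
Proof.
move=> a0 gs tr; rewrite /merit.
have La0 : 0 <= L2 * a by rewrite mulr_ge0 // ltW.
have h1 := ler_wpM2l La0 (trial_zhalf_dist s a x a0 gs tr).
move=> /le_trans /(_ h1); rewrite [X in _ <= X -> _]mulrA.
have := mulr_ge0 La0 D_ge0; move: (L2 * a * D) => t t0 h.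
rewrite leNgt; apply/negP => t30.
have : t * (30 * t) <= t by rewrite ler_piMr // ltW.
by move: h t30; lra.
Qed.

(** * Modulus of continuity of the merit and width of a bracket *)

Lemma ratio_increment s a a' : 0 <= st_A s -> 0 < a' -> a' <= a ->
  0 <= ratio s a - ratio s a' <= (a - a') / a'.
Proof.
move=> A0 a'0 aa'; have a0 := lt_le_trans a'0 aa'.
have -> : ratio s a - ratio s a' =
    (a - a') / a' * (st_A s * a' / ((st_A s + a) * (st_A s + a'))).
  by rewrite /ratio; field; rewrite !gt_eqF //; lra.
have d0 : 0 <= (a - a') / a' by rewrite divr_ge0 ?subr_ge0 // ltW.
have Aa : 0 < (st_A s + a) * (st_A s + a') by rewrite mulr_gt0 //; lra.
set k := st_A s * a' / _.
have k0 : 0 <= k by apply: divr_ge0 (mulr_ge0 A0 (ltW a'0)) (ltW Aa).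
have k1 : k <= 1.
  rewrite ler_pdivrMr // mul1r.
  have := mulr_ge0 A0 A0; have := mulr_ge0 A0 (ltW a0).
  by have := mulr_ge0 (ltW a0) (ltW a'0); lra.
by apply/andP; split; [exact: mulr_ge0|rewrite ler_piMr].
Qed.

(** The coefficients collect the three terms of [trial_stability]: 34 = 12 + 22, 715 = 85 + 98 + 14
    * 38 and 1190 = 14 * 85. *)
Lemma bracket_increments s l u xl xu (dl t : R) :
  dl = (u - l) / l -> t = L2 * u * D -> 0 < l -> l <= u -> dl <= 1 -> good s ->
  trial F H z0 s l xl -> trial F H z0 s u xu ->
  enorm (zhalf F z0 s u - zhalf F z0 s l) <= 14 * (D * dl) /\
  enorm (xu - xl) <= D * dl * (34 + 715 * t + 1190 * t ^+ 2).
Proof.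
move=> dlE tE l0 lu dl1 gs trl tru; have u0 := lt_le_trans l0 lu.
have [A0 Hz V0 dz] := gs.
have := ratio_increment s u l A0 l0 lu; rewrite -dlE => /andP[dr0 dr1].
have dl0 : 0 <= dl := le_trans dr0 dr1.
have t0 : 0 <= t by rewrite tE !mulr_ge0 // ltW.
have tl : L2 * l * D <= t by rewrite tE ler_wpM2r // ler_wpM2l // ltW.
have Ddl0 : 0 <= D * dl by rewrite mulr_ge0.
have dzz0 : enorm (st_z s - z0) <= 12 * D.
  apply: le_trans (ler_enormD_via zs _ _) _; rewrite (enormBC zs).
  by move: dz; local_lra.
have dc : enorm (anchor z0 s u - anchor z0 s l) <= 12 * (D * dl).
  have -> : anchor z0 s u - anchor z0 s l =
      (ratio s u - ratio s l) *: (z0 - st_z s).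
    by rewrite !anchorE //; apply/rowP => i; rewrite !mxE; ring.
  rewrite enormZ ger0_norm // enormBC mulrA [_ * dl]mulrC.
  by apply: ler_pM => //; exact: enorm_ge0.
have dw : enorm (zhalf F z0 s u - zhalf F z0 s l) <= 14 * (D * dl).
  have -> : zhalf F z0 s u - zhalf F z0 s l = (anchor z0 s u - anchor z0 s l)
     - (ratio s u - ratio s l) *: (st_A s *: G s).
    rewrite !zhalfE //; move: (G s) (anchor z0 s u) (anchor z0 s l) => g c c'.
    by apply/rowP => i; rewrite !mxE; ring.
  apply: le_trans (ler_enormB _ _) _.
  rewrite enormZ ger0_norm // enormZ ger0_norm //.
  have : (ratio s u - ratio s l) * (st_A s * enorm (G s)) <= dl * (2 * D).
    by apply: ler_pM => //; [rewrite mulr_ge0 ?enorm_ge0|exact: A_residual_le].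
  by move: dc; local_lra.
split=> //.
have dxlw : enorm (xl - zhalf F z0 s u) <= D * (38 + 85 * t).
  apply: le_trans (ler_enormD_via (zhalf F z0 s l) _ _) _.
  rewrite (enormBC (zhalf F z0 s l)).
  move: (trial_zhalf_dist s l xl l0 gs trl) (ler_wpM2l D_ge0 tl).
  move: (ler_wpM2l D_ge0 dl1) dw.
  by local_lra.
have lin :
    u * enorm (linearization (zhalf F z0 s u) xl - linearization (zhalf F z0 s l) xl)
    <= D * dl * (98 * t + 14 * t * (38 + 85 * t)).
  (* One of the two factors [dl] is replaced by 1, which keeps the estimate linear in [dl]. *)
  have dw2 : enorm (zhalf F z0 s u - zhalf F z0 s l) ^+ 2 <=
      (14 * (D * dl)) * (14 * D).
    rewrite expr2; apply: ler_pM; rewrite ?enorm_ge0 //.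
    by apply: le_trans dw _; rewrite ler_pM2l // ler_piMr.
  have dww : enorm (zhalf F z0 s u - zhalf F z0 s l) * enorm (xl - zhalf F z0 s u)
      <= (14 * (D * dl)) * (D * (38 + 85 * t)).
    by apply: ler_pM; rewrite ?enorm_ge0.
  have uL0 : 0 <= L2 * u by rewrite mulr_ge0 // ltW.
  apply: le_trans (ler_wpM2l (ltW u0) (linearization_lip _ _ _)) _.
  move: (ler_wpM2l uL0 dw2) (ler_wpM2l uL0 dww).
  by rewrite tE; local_lra.
have dcx : dl * enorm (anchor z0 s l - xl) <= D * dl * (22 + 85 * t).
  apply: le_trans (ler_wpM2l dl0 (trial_anchor_dist s l xl l0 gs trl)) _.
  by move: (ler_wpM2l Ddl0 tl); local_lra.
have := trial_stability s u l xu xl l0 lu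
  (solution_inclusion _ _ _ u0 tru.1) (solution_inclusion _ _ _ l0 trl.1).
by rewrite -dlE => /le_trans; apply; move: dc dcx lin; local_lra.
Qed.

(* Here [dl := (u - l) / l <= 1]; every quantity entering the merit changes by
   at most [dl] times a polynomial in [t = L2 u D] between [l] and [u], whereas
   the merit changes by more than [sqrt 2 - 1]. *)
Lemma bracket_width_large s l u xl xu :
  0 < l -> l <= u -> u <= 2 * l -> good s ->
  trial F H z0 s l xl -> trial F H z0 s u xu ->
  merit F z0 L2 s l xl < 1 -> Num.sqrt 2 < merit F z0 L2 s u xu ->
  u <= 2 ^+ 13 * (1 + L2 * u * D) ^+ 3 * (u - l).
Proof.
move=> l0 lu u2l gs trl tru; have u0 := lt_le_trans l0 lu.
move dlE : ((u - l) / l) => dl; move tE : (L2 * u * D) => t.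
have dl0 : 0 <= dl by rewrite -dlE divr_ge0 ?subr_ge0 // ltW.
have dl1 : dl <= 1 by rewrite -dlE ler_pdivrMr // mul1r; move: u2l; local_lra.
have t0 : 0 <= t by rewrite -tE !mulr_ge0 // ltW.
have tl : L2 * l * D <= t by rewrite -tE ler_wpM2r // ler_wpM2l // ltW.
have [dw dx] :=
  bracket_increments _ _ _ _ _ _ _ (esym dlE) (esym tE) l0 lu dl1 gs trl tru.
have Ll0 : 0 <= L2 * l by rewrite mulr_ge0 // ltW.
have Lul0 : 0 <= L2 * (u - l) by rewrite mulr_ge0 ?subr_ge0 // ltW.
have h1 : enorm (xu - zhalf F z0 s u) <=
    enorm (xl - zhalf F z0 s l) + D * dl * (48 + 715 * t + 1190 * t ^+ 2).
  apply: le_trans (ler_enormD_via xl _ _) _.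
  have := ler_enormD_via (zhalf F z0 s l) xl (zhalf F z0 s u).
  by rewrite (enormBC (zhalf F z0 s l)); move: dw dx; local_lra.
have h2 := ler_wpM2l Ll0 h1.
have h3 := ler_wpM2l Lul0 (trial_zhalf_dist s u xu u0 gs tru).
have uldl : L2 * (u - l) * D = dl * (L2 * l * D).
  by rewrite -dlE; field; rewrite gt_eqF.
have h4 : L2 * l * D * dl * (72 + 800 * t + 1190 * t ^+ 2) <=
    t * dl * (72 + 800 * t + 1190 * t ^+ 2).
  apply: ler_wpM2r; last exact: ler_wpM2r.
  by move: t0 (sqr_ge0 t); local_lra.
rewrite (mulrA _ D) uldl tE in h3.
have /andP[s2 _] := sqrt2_bounds R.
rewrite /merit => ml mu.
(* The gap is [Num.sqrt 2 - 1]. With [u = l + (u - l)] in the merit at [u], the coefficients of [h1]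
   and of [trial_zhalf_dist] add up: 72 = 48 + 24 and 800 = 715 + 85. *)
have dif : 2 / 5 <= dl * (t * (72 + 800 * t + 1190 * t ^+ 2)).
  by move: h2 h3 h4 ml mu s2; local_lra.
have cub : t * (72 + 800 * t + 1190 * t ^+ 2) <= 1200 * (1 + t) ^+ 3.
  by move: t0 (mulr_ge0 t0 t0) (mulr_ge0 (mulr_ge0 t0 t0) t0); local_lra.
have := ler_wpM2l (ltW l0) (le_trans dif (ler_wpM2l dl0 cub)).
have -> : l * (dl * (1200 * (1 + t) ^+ 3)) = 1200 * (1 + t) ^+ 3 * (u - l).
  by rewrite -dlE; field; rewrite gt_eqF.
(* Dividing by 2/5 and using [u <= 2 * l] turns 1200 into 6000, below [2 ^+ 13]. *)
by move: u2l l0; local_lra.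
Qed.

(** If [u] exceeds [2 * l], in particular if [l = 0], where no trial was made, the width is already
    more than [u / 2]. To pass from [u] to [ub], the large merit at [u] gives
    [1 <= 30 * (L2 * u * D)], and multiplying by [ub] costs one more power and [30 <= 2 ^+ 5]. *)
Lemma bracket_width s l u ub xu :
  0 <= l -> l < u -> u <= ub -> good s -> trial F H z0 s u xu ->
  Num.sqrt 2 < merit F z0 L2 s u xu ->
  (l = 0 \/
   0 < l /\ exists2 xl, trial F H z0 s l xl & merit F z0 L2 s l xl < 1) ->
  ub <= 2 ^+ 18 * (1 + L2 * ub * D) ^+ 4 * (u - l).
Proof.
move=> l0 lu uub gs tru mu hl; have u0 := le_lt_trans l0 lu.
have t0 : 0 <= L2 * u * D by rewrite !mulr_ge0 // ltW.
have tT : L2 * u * D <= L2 * ub * D by rewrite ler_wpM2r // ler_wpM2l // ltW.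
have u_le : u <= 2 ^+ 13 * (1 + L2 * u * D) ^+ 3 * (u - l).
  have pw : 1 <= (1 + L2 * u * D) ^+ 3 by rewrite exprn_ege1 // lerDl.
  have ul : 0 < u - l by rewrite subr_gt0.
  have [u2l|u2l] := lerP u (2 * l).
    case: hl => [le0|[lp [xl trl ml]]].
      by move: u2l u0; rewrite le0; local_lra.
    exact: bracket_width_large (ltW lu) u2l gs trl tru ml mu.
  by move: (ler_wpM2r (ltW ul) pw) u2l u0; local_lra.
have s1 : 1 < Num.sqrt 2 :> R.
  by have /andP[] := sqrt2_bounds R; local_lra.
have t30 := merit_ge1_step s u xu u0 gs tru (ltW (lt_trans s1 mu)).
have ub0 := lt_le_trans u0 uub.
have h1 := ler_wpM2l (ltW ub0) t30.
move: tT t0 u_le h1; set t := L2 * u * D; set T := L2 * ub * D => tT t0 u_le h1.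
have e : ub * (30 * t) = 30 * T * u by rewrite /t /T; ring.
rewrite e mulr1 in h1.
have T0 := le_trans t0 tT.
have := ler_wpM2l (mulr_ge0 (ler0n R 30) T0) u_le => h2.
apply: le_trans h1 (le_trans h2 _).
have ul : 0 <= u - l by rewrite subr_ge0 ltW.
rewrite [30 * T * _]mulrA; apply: ler_wpM2r => //.
have p3 : (1 + t) ^+ 3 <= (1 + T) ^+ 3.
  by rewrite ler_pXn2r ?nnegrE ?addr_ge0 // lerD2l.
have p0 : 0 <= (1 + t) ^+ 3 by rewrite exprn_ge0 // addr_ge0.
have T1 : 0 <= 1 + T by rewrite addr_ge0.
move: (ler_wpM2l T1 p3) (mulr_ge0 T0 p0) (p0); rewrite -exprS.
by move: ((1 + t) ^+ 3) ((1 + T) ^+ 4) => p q; local_lra.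
Qed.

(** * Termination of the bisection and the logarithmic count *)

Lemma abar_gt0 s : 0 < abar F L2 eps s.
Proof.
rewrite /abar lt_max sqrtr_gt0; apply/orP; right.
by apply: divr_gt0; apply: mulr_gt0.
Qed.

Lemma bisection_accepts s (l u : R) n s' : bisection F H z0 L2 s l u n s' ->
  0 <= l -> 0 < u ->
  exists a x, [/\ 0 < a, trial F H z0 s a x, merit F z0 L2 s a x <= Num.sqrt 2
    & s' = Defs.next F z0 s a x].
Proof.
have mid (l' u' : R) : 0 <= l' -> 0 < u' -> 0 < (l' + u') / 2.
  by move=> l0 u0; rewrite divr_gt0 // ltr_wpDl.
elim=> {l u n s'}
  [l u z tr /andP[_ m]|l u z n s' _ _ _ IH|l u z n s' _ _ _ IH] l0 u0.
- by exists ((l + u) / 2), z; split=> //; exact: mid.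
- by apply: IH => //; exact/ltW/mid.
- by apply: IH => //; exact: mid.
Qed.

Lemma reached_good k s : reached F H z0 L2 eps k s -> good s.
Proof.
elim=> {k s} [v0 Hv0|k s n s' _ gs _ ls].
  split=> //=; first by rewrite /potential /= expr0n !mul0r addr0.
  by rewrite -[leLHS]mul1r ler_wpM2r // ler1n.
inversion ls as [|z m s'' tr mer bis]; subst.
have [a [x [a0 tr' mer' ->]]] :=
  bisection_accepts _ _ _ _ _ bis (lexx 0) (abar_gt0 s).
exact: good_next.
Qed.

(** Here [n] bounds the trials still to come. Each rejected trial halves the width and preserves the
    merit conditions at the ends; at [n = 0] the width hypothesis contradicts [bracket_width]. *)
Lemma bisection_terminates s (ub : R) n : good s -> forall l u : R,
  0 <= l -> l < u -> u <= ub ->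
  (l = 0 \/
   0 < l /\ exists2 xl, trial F H z0 s l xl & merit F z0 L2 s l xl < 1) ->
  (exists2 xu, trial F H z0 s u xu & Num.sqrt 2 < merit F z0 L2 s u xu) ->
  2 ^+ 18 * (1 + L2 * ub * D) ^+ 4 * (u - l) < 2 ^+ n * ub ->
  exists m s', bisection F H z0 L2 s l u m s' /\ (m <= n)%N.
Proof.
move=> gs; elim: n => [|n IH] l u l0 lu uub hl [xu tru mu] wid.
  rewrite expr0 mul1r in wid.
  by have := le_lt_trans (bracket_width s l u ub xu l0 lu uub gs tru mu hl) wid;
    rewrite ltxx.
have m0 : 0 < (l + u) / 2 by rewrite divr_gt0 // ltr_wpDl // (le_lt_trans l0).
have lm : l < (l + u) / 2 by move: lu; local_lra.
have mub : (l + u) / 2 < u by move: lu; local_lra.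
have [z tr] := trial_exists s ((l + u) / 2) m0.
have wid' (w : R) : w = (u - l) / 2 ->
    2 ^+ 18 * (1 + L2 * ub * D) ^+ 4 * w < 2 ^+ n * ub.
  move=> ->; rewrite mulrA ltr_pdivrMr //; apply: lt_le_trans wid _.
  by rewrite exprSr mulrAC.
have [small|ge1] := ltP (merit F z0 L2 s ((l + u) / 2) z) 1.
  have [||||||m [s' [bis mn]]] := IH ((l + u) / 2) u.
  - exact: ltW.
  - by [].
  - by [].
  - by right; split=> //; exists z.
  - by exists xu.
  - by apply: wid'; field.
  by exists m.+1, s'; split=> //; exact: bisection_small tr small bis.
have [le2|gt2] := leP (merit F z0 L2 s ((l + u) / 2) z) (Num.sqrt 2).
  exists 1%N, (Defs.next F z0 s ((l + u) / 2) z); split=> //.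
  by apply: bisection_accept => //; rewrite ge1.
have [||||||m [s' [bis mn]]] := IH l ((l + u) / 2).
- by [].
- by [].
- exact: le_trans (ltW mub) uub.
- by [].
- by exists z.
- by apply: wid'; field.
by exists m.+1, s'; split=> //; exact: bisection_large tr gt2 bis.
Qed.

Lemma line_search_terminates s n : good s ->
  2 ^+ 18 * (1 + L2 * abar F L2 eps s * D) ^+ 4 < 2 ^+ n ->
  exists m o, line_search F H z0 L2 eps s m o /\ (m <= n.+1)%N.
Proof.
move=> gs wid; have ub0 := abar_gt0 s.
have [z tr] := trial_exists s (abar F L2 eps s) ub0.
have [le2|gt2] := leP (merit F z0 L2 s (abar F L2 eps s) z) (Num.sqrt 2).
  by exists 1%N, (Finish z); split=> //; exact: line_search_finish tr le2.
have [|||m [s' [bis mn]]] :=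
  bisection_terminates s (abar F L2 eps s) n gs 0 _ (lexx _) ub0 (lexx _).
- by left.
- by exists z.
- by rewrite subr0 ltr_pM2r.
by exists m.+1, (Accept s'); split=> //; exact: line_search_bisect tr gt2 bis.
Qed.

(** Let [T = L2 * abar * D] and [rho = L2 * D^2 / eps]. In the square root branch [T^2] is a
    multiple of [rho], and [(T - 2)^2 >= 0] makes this linear; in the other branch [A_residual_le]
    gives [T <= 4 rho]. *)
Lemma abar_bound s : good s ->
  1 + L2 * abar F L2 eps s * D <= 4 * (1 + L2 * D ^+ 2 / eps).
Proof.
move=> [A0 Hz V0 _]; have res := A_residual_le s A0 Hz V0.
move rhoE : (L2 * D ^+ 2 / eps) => rho.
have rho0 : 0 <= rho by rewrite -rhoE divr_ge0 ?mulr_ge0 ?sqr_ge0 // ltW.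
rewrite /abar; case: (leP (2 * st_A s * residual F s / eps)) => _.
  set y := Num.sqrt _.
  have y2 : (L2 * y * D) ^+ 2 = 2 * (1 + Num.sqrt 2) * rho.
    rewrite !exprMn sqr_sqrtr -?rhoE.
      by field; rewrite !gt_eqF.
    by rewrite divr_ge0 ?mulr_ge0 ?addr_ge0 ?sqrtr_ge0 // ltW.
  have /andP[_ s2] := sqrt2_bounds R.
  move: y2 (sqr_ge0 (L2 * y * D - 2)) (ler_wpM2l rho0 s2) (rho0).
  by move: (L2 * y * D) (Num.sqrt 2) => T q; local_lra.
have -> : L2 * (2 * st_A s * residual F s / eps) * D
    = 2 * (L2 / eps * D * (st_A s * residual F s)) by ring.
have k0 : 0 <= L2 / eps * D by rewrite mulr_ge0 // divr_ge0 // ltW.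
have := ler_wpM2l k0 res.
have -> : L2 / eps * D * (2 * D) = 2 * rho by rewrite -rhoE; ring.
by move: (L2 / eps * D * _) rho0 => q; local_lra.
Qed.

End Iterates.

Lemma ln2_ge (R : realType) : 1 / 2 <= ln 2 :> R.
Proof.
have := @le_ln1Dx R (- (1 / 2)).
rewrite (_ : 1 + - (1 / 2) = 2^-1) ?lnV ?posrE //.
  by rewrite lerN2; apply; lra.
by field.
Qed.

(** The witness is one more than the integer part of [8 * ln x]; since [ln 2] is at least 1/2, its
    product with [ln 2] exceeds [4 * ln x]. *)
Lemma exists_pow2_gt (R : realType) (x : R) : 1 <= x ->
  exists n, x ^+ 4 < 2 ^+ n /\ n%:R <= 1 + 8 * ln x.
Proof.
move=> x1; have x0 : 0 < x := lt_le_trans ltr01 x1.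
have l0 : 0 <= 8 * ln x by rewrite mulr_ge0 ?ln_ge0.
have /andP[lo hi] := truncn_itv l0.
exists (Num.truncn (8 * ln x)).+1; split; last by rewrite -natr1; lra.
rewrite -ltr_ln ?posrE ?exprn_gt0 // !lnXn //.
move: hi (ler_wpM2l (ler0n R (Num.truncn (8 * ln x)).+1) (ln2_ge R)).
rewrite -(mulr_natl (ln x)) -(mulr_natl (ln 2)).
by move: (Num.truncn _).+1%:R => m; lra.
Qed.

Theorem theorem4p6 (R : realType) :
  exists C : R, 0 < C /\
  forall (d : nat) (F : 'rV[R]_d -> 'rV[R]_d) (H : 'rV[R]_d -> set 'rV[R]_d)
    (L2 eps : R) (zs z0 : 'rV[R]_d),
  0 < L2 -> 0 < eps ->
  monotone_map F ->
  (forall z, differentiable F z) ->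
  (forall z z', opnorm (fun u => 'd F z u - 'd F z' u) <= L2 * enorm (z - z')) ->
  maximally_monotone H ->
  (exists2 w, H zs w & 0 = F zs + w) ->
  domain H z0 ->
  forall (k : nat) (s : state R d),
  reached F H z0 L2 eps k s -> eps < residual F s ->
  exists (n : nat) (o : outcome R d),
    line_search F H z0 L2 eps s n o /\
    n%:R <= C * (1 + ln (1 + L2 * enorm (z0 - zs) ^+ 2 / eps)).
Proof.
(* 28 = 26 + 1 + 1: the constant halvings, the initial trial, and the 1 in the bound on [n]; it also
   dominates the coefficient 8 of the logarithm. *)
exists 28; split=> // d F H L2 eps zs z0 L2_gt0 eps_gt0 F_mono F_diff F_lip H_max.
move=> [w Hw zsE] H_z0 k s rs _.
have H_zs : H zs (- F zs).
  by suff -> : - F zs = w by []; apply/eqP; rewrite eq_sym -addr_eq0 addrC -zsE.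
have gs : good F H zs z0 s.
  exact: (reached_good F H L2 eps zs z0 L2_gt0 eps_gt0 F_mono F_diff F_lip
    H_max H_zs k).
have ab := abar_bound F H L2 eps zs z0 L2_gt0 eps_gt0 F_mono H_max H_zs s gs.
have x1 : 1 <= 1 + L2 * enorm (z0 - zs) ^+ 2 / eps.
  rewrite lerDl; apply: divr_ge0 (ltW eps_gt0).
  by apply: mulr_ge0 (sqr_ge0 _); exact: ltW.
have [n [wid nle]] := exists_pow2_gt _ _ x1.
(* 26 = 18 + 8, where [2 ^+ 8] is the fourth power of the factor 4 in [abar_bound]. *)
have [|m [out [ls mn]]] := line_search_terminates F H L2 eps zs z0 L2_gt0 eps_gt0
  F_mono F_diff F_lip H_max H_zs H_z0 s (26 + n) gs.
  have ab0 : 0 <= 1 + L2 * abar F L2 eps s * enorm (z0 - zs).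
    apply: addr_ge0 => //; apply: mulr_ge0 (enorm_ge0 _).
    by apply: mulr_ge0; apply: ltW => //; exact: abar_gt0.
  have : (1 + L2 * abar F L2 eps s * enorm (z0 - zs)) ^+ 4 <=
      (4 * (1 + L2 * enorm (z0 - zs) ^+ 2 / eps)) ^+ 4.
    by rewrite ler_pXn2r ?nnegrE // (le_trans ab0).
  rewrite exprMn exprD; move: wid.
  by move: (_ ^+ 4) (_ ^+ 4) (2 ^+ n) => p q r; lra.
exists m, out; split=> //; apply: le_trans (_ : (26 + n).+1%:R <= _).
  by rewrite ler_nat.
rewrite -natr1 natrD; move: nle (ln_ge0 x1).
by move: (ln _) (n%:R) => p q; lra.
Qed.
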